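(* Let $p>3$ be a prime and $m,n\in R_p$ with $m\not\equiv 0\pmod p$. Put $u=\dfrac{4m^3+27n^2}{12^3\cdot 4m^3}\in R_p$. Then $$\left(\sum_{x=0}^{p-1}\left(\frac{x^3+mx+n}{p}\right)\right)^2\equiv \left(\frac{-3m}{p}\right)\sum_{k=0}^{p-1}\binom{2k}{k}\binom{3k}{k}\binom{6k}{3k}u^k\equiv \left(\frac{-3m}{p}\right)\sum_{k=0}^{[p/6]}\binom{2k}{k}\binom{3k}{k}\binom{6k}{3k}u^k\pmod p.$$ Moreover, if $\sum_{x=0}^{p-1}\left(\frac{x^3+mx+n}{p}\right)=0$, then $$\sum_{k=0}^{p-1}\binom{2k}{k}\binom{3k}{k}\binom{6k}{3k}u^k\equiv 0\pmod{p^2}.$$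
   Context: $R_p$ is the ring of rational numbers whose denominator is coprime to $p$; congruences modulo $p$ and $p^2$ are in $R_p$. $\left(\frac{a}{p}\right)$ is the Legendre symbol, extended to $a\in R_p$ via the residue class of $a$ modulo $p$ (and equal to $0$ if $a\equiv 0\pmod p$). $[x]$ is the greatest integer not exceeding $x$. *)

(* Defs.v *)
From mathcomp Require Import all_boot all_order all_algebra.

Set Implicit Arguments.
Unset Strict Implicit.
Unset Printing Implicit Defensive.

Import GRing.Theory.

Local Open Scope ring_scope.

(* The ring R_p; [denq r] is the denominator of [r] in lowest terms. *)
Definition Rp (p : nat) : {pred rat} :=
  [pred r : rat | coprime `|denq r|%N p].

(* a = b (mod q) in the ring R_p, i.e. modulo the ideal q R_p. *)
Definition Rp_congr (p q : nat) (a b : rat) : Prop :=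
  [/\ a \in Rp p, b \in Rp p & exists2 c, c \in Rp p & a - b = q%:R * c].

(* Residue class of [a] modulo a prime [p]: [ratr a] is
   (numq a)%:~R / (denq a)%:~R, and the denominator is nonzero in 'F_p
   exactly when [a] is in R_p. *)
Definition Rp_residue (p : nat) (a : rat) : 'F_p := ratr a.

Definition legendre (p : nat) (a : rat) : int :=
  let r := Rp_residue p a in
  if r == 0 then 0
  else if [exists y : 'F_p, y ^+ 2 == r] then 1 else -1.

Definition binom_sum (N : nat) (u : rat) : rat :=
  \sum_(0 <= k < N)
    ('C(2 * k, k) * 'C(3 * k, k) * 'C(6 * k, 3 * k))%:R * u ^+ k.

Definition cubic_char_sum (p : nat) (m n : rat) : int :=
  \sum_(0 <= x < p) legendre p (x%:R ^+ 3 + m * x%:R + n).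

(* Main.v *)
From HB Require Import structures.
From mathcomp Require Import all_boot all_order all_algebra all_solvable finfield.
From mathcomp Require Import ring zify.
Require Import Defs.

(** Put h = (p - 1)/2, a_k = C(3k,k) C(6k,3k) and b_k = C(2k,k) a_k, and let H
    be the coefficient of X^(p-1) in (X^3 + m X + n)^h. Euler's criterion turns
    the character sum into the sum over F_p of the values of this polynomial of
    degree less than 2(p-1), which is -H modulo p ([cubic_char_sum_eqm]).

    The key step is to write m = -3c^2, after adjoining a square root c to R_p,
    and to translate X by the critical point c. This does not change H modulo p,
    and the cubic becomes X^2 (X + 3c) + e with e = n - 2c^3, so that H is a sum
    over a single index. As C(h,j) (-4)^j = C(2j,j) modulo p, that sum is
    (3c)^h F(x) with F(x) = sum_{k<p} a_k x^k and x = (2c^3 - n)/(12c)^3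
    ([hasse_coef]).

    Clausen's formula (sum a_k x^k)^2 = sum b_k (x (1 - 432x))^k is an identity
    of power series, proved by comparing differential equations
    ([clausen_coef]). By the p-adic valuations of a_k and b_k it survives the
    truncation of both series at k < p modulo p^2 ([clausen_congr]). For the x
    above, x (1 - 432x) is exactly the u of the statement.

    Hence H^2 = (9c^2)^h F(x)^2 = (-3m)^h sum_{k<p} b_k u^k modulo p, where
    (-3m)^h is the Legendre symbol of -3m; the terms with k > p/6 vanish modulo
    p. If the character sum is zero, then p divides H, hence F(x) because 3c is
    a unit, and so p^2 divides F(x)^2 and the sum of the b_k u^k. The
    congruences live in R_p[c], but only involve elements of R_p, to which they
    descend ([sqrt_extension], [hasse_clausen]). *)

Set Implicit Arguments.
Unset Strict Implicit.
Unset Printing Implicit Defensive.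

Import Order.TTheory GRing.Theory Num.Theory.

(** * Binomial products and their valuations *)

(** (6k)! / (k! (2k)! (3k)!), see [sextic_fact]. *)
Definition sextic k := 'C(3 * k, k) * 'C(6 * k, 3 * k).

Lemma central_bin_fact k : 'C(2 * k, k) * (k`! * k`!) = (2 * k)`!.
Proof. by rewrite -(@bin_fact (2 * k) k) ?mul2n -?addnn ?addnK ?leq_addl. Qed.

Lemma sextic_fact k : sextic k * (k`! * (2 * k)`! * (3 * k)`!) = (6 * k)`!.
Proof.
have le_k_3k : k <= 3 * k by lia.
have le_3k_6k : 3 * k <= 6 * k by lia.
have := bin_fact le_k_3k; have := bin_fact le_3k_6k.
have -> : 6 * k - 3 * k = 3 * k by lia.
have -> : 3 * k - k = 2 * k by lia.
rewrite /sextic => E1 E2; rewrite -E1 -E2; ring.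
Qed.

Lemma central_bin_rec k :
  k.+1 * 'C(2 * k.+1, k.+1) = 2 * (2 * k).+1 * 'C(2 * k, k).
Proof.
apply/eqP; rewrite -(@eqn_pmul2r (k.+1 * k`! * k`!)) ?muln_gt0 ?fact_gt0 //.
have := central_bin_fact k.+1; have := central_bin_fact k.
rewrite (_ : 2 * k.+1 = (2 * k).+2); last by lia.
rewrite !factS => <- E; apply/eqP.
transitivity ('C((2 * k).+2, k.+1) * (k.+1 * k`! * (k.+1 * k`!))); first by ring.
by rewrite E; ring.
Qed.

Lemma sextic_rec k :
  k.+1 ^ 2 * sextic k.+1 = 12 * (6 * k).+1 * (6 * k).+4.+1 * sextic k.
Proof.
have := sextic_fact k.+1; have := sextic_fact k.
rewrite (_ : 2 * k.+1 = (2 * k).+2); last by lia.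
rewrite (_ : 3 * k.+1 = (3 * k).+3); last by lia.
rewrite (_ : 6 * k.+1 = (6 * k).+4.+2); last by lia.
rewrite !factS => <- E; apply/eqP.
rewrite -(@eqn_pmul2r (6 * k.+1 * (2 * k).+1 * (3 * k).+1 * (3 * k).+2 *
                       (k`! * (2 * k)`! * (3 * k)`!))) ?muln_gt0 ?fact_gt0 //.
apply/eqP; move: k`! (2 * k)`! (3 * k)`! E => A B C.
move: (sextic k.+1) (sextic k) => s t E.
transitivity (s * (k.+1 * A * ((2 * k).+2 * ((2 * k).+1 * B)) *
       ((3 * k).+3 * ((3 * k).+2 * ((3 * k).+1 * C))))); first by ring.
by rewrite E; ring.
Qed.

Section Valuation.
Variable p : nat.
Hypothesis p_pr : prime p.

Lemma logn_fact_small n : n < p ^ 2 -> logn p n`! = n %/ p.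
Proof.
move=> lt_n_p2; rewrite logn_fact //.
case: n lt_n_p2 => [|n] lt_n_p2; first by rewrite big_geq // div0n.
rewrite big_ltn // expn1 big_nat big1 ?addn0 // => i /andP[lt1i _].
by rewrite divn_small // (leq_trans lt_n_p2) // leq_pexp2l ?prime_gt0.
Qed.

Hypothesis p_gt3 : 3 < p.

(** Legendre's formula has a single term here, since 6 k < p ^ 2. *)
Lemma logn_sextic k : k < p ->
  logn p (sextic k) + (2 * k) %/ p + (3 * k) %/ p = (6 * k) %/ p.
Proof.
move=> lt_kp.
have p5 : 4 < p by rewrite ltn_neqAle p_gt3 andbT; apply: contraTneq p_pr => <-.
have lt6 : 6 * k < p ^ 2 by rewrite -mulnn; nia.
have s_gt0 : 0 < sextic k by rewrite muln_gt0 !bin_gt0; lia.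
rewrite -(logn_fact_small lt6) -sextic_fact.
move: (sextic k) s_gt0 => s s_gt0.
rewrite !lognM ?muln_gt0 ?fact_gt0 //.
rewrite !logn_fact_small; try lia.
by rewrite (divn_small lt_kp); lia.
Qed.

(** With a and b the integral parts of 2k/p and 3k/p, the inequality
    a + b < 6k/p holds for each of the possible a < 2 and b < 3. *)
Lemma dvdn_sextic k : p %/ 6 < k < p -> p %| sextic k.
Proof.
move=> /andP[]; rewrite ltn_divLR // => lt_pk lt_kp; have := logn_sextic lt_kp.
rewrite -[X in X %| _]expn1 pfactor_dvdn //; last by rewrite muln_gt0 !bin_gt0; lia.
have p_gt0 : 0 < p by apply: prime_gt0.
have : (2 * k) %/ p < 2 by rewrite ltn_divLR //; lia.
have : (3 * k) %/ p < 3 by rewrite ltn_divLR //; lia.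
have := leq_divM (2 * k) p; have := leq_divM (3 * k) p.
move: ((3 * k) %/ p) ((2 * k) %/ p) => b a le_bp le_ap lt_b3 lt_a2 E.
have le_ab : a + b + 1 <= (6 * k) %/ p.
  rewrite leq_divRL //.
  case: a lt_a2 le_ap {E} => [|[|//]] _ le_ap;
    by case: b lt_b3 le_bp => [|[|[|//]]] _ le_bp; lia.
by lia.
Qed.

Lemma dvdn_sextic2 k : 5 * p <= 6 * k -> k < p -> p ^ 2 %| sextic k.
Proof.
move=> le_pk lt_kp; have := logn_sextic lt_kp.
rewrite pfactor_dvdn //; last by rewrite muln_gt0 !bin_gt0; lia.
have p_gt0 : 0 < p by apply: prime_gt0.
have : (2 * k) %/ p < 2 by rewrite ltn_divLR //; lia.
have : (3 * k) %/ p < 3 by rewrite ltn_divLR //; lia.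
have : 5 <= (6 * k) %/ p by rewrite leq_divRL.
by lia.
Qed.

Lemma dvdn_central_bin k : p <= 2 * k -> k < p -> p %| 'C(2 * k, k).
Proof.
move=> le_pk lt_kp; have p_gt1 := prime_gt1 p_pr.
have b0 : 0 < 'C(2 * k, k) by rewrite bin_gt0; lia.
rewrite -[X in X %| _]expn1 pfactor_dvdn //.
have /(congr1 (logn p)) := central_bin_fact k.
rewrite !lognM ?muln_gt0 ?fact_gt0 // !logn_fact_small; try nia.
rewrite (divn_small lt_kp) => E.
have : 0 < (2 * k) %/ p by rewrite divn_gt0 // prime_gt0.
by lia.
Qed.

End Valuation.

Local Open Scope ring_scope.

Definition sextic_cube k := ('C(2 * k, k) * sextic k)%N.

(** The shape of the recurrence that Clausen's formula requires, with
    kappa = 432 and lambda = 60. *)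
Lemma sextic_rec_quad k :
  (k.+1 ^ 2 * sextic k.+1 = (432 * (k * k.+1) + 60) * sextic k)%N.
Proof. by rewrite sextic_rec; congr (_ * _)%N; lia. Qed.

Lemma sextic_cube_rec k :
  (k.+1 ^ 3 * sextic_cube k.+1 =
   2 * (2 * k).+1 * (432 * (k * k.+1) + 60) * sextic_cube k)%N.
Proof.
rewrite expnS mulnACA central_bin_rec sextic_rec_quad /sextic_cube.
by rewrite mulnACA -!mulnA.
Qed.

Lemma prime_dvd_fact p n : prime p -> (p %| n`!)%N = (p <= n)%N.
Proof.
move=> p_pr; apply/idP/idP => [|le_pn]; last by rewrite dvdn_fact // prime_gt0.
elim: n => [|n IHn]; first by rewrite fact0 Euclid_dvd1.
by rewrite factS Euclid_dvdM // => /orP[/dvdn_leq->//|/IHn/leqW].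
Qed.

Lemma trinomial_bin h l : (3 * l <= h)%N ->
  ('C(h, l) * 'C(h - l, 2 * l) = 'C(h, 3 * l) * 'C(3 * l, l))%N.
Proof.
move=> le_lh.
have l1 : (l <= h)%N by lia.
have l2 : (2 * l <= h - l)%N by lia.
have l3 : (l <= 3 * l)%N by lia.
have := bin_fact l1; have := bin_fact l2; have := bin_fact l3; have := bin_fact le_lh.
rewrite (_ : h - l - 2 * l = h - 3 * l)%N; last by lia.
rewrite (_ : 3 * l - l = 2 * l)%N; last by lia.
move=> E1 E2 E3 E4; apply/eqP.
rewrite -(@eqn_pmul2r (l`! * (2 * l)`! * (h - 3 * l)`!)) ?muln_gt0 ?fact_gt0 //.
apply/eqP; transitivity h`!; first by rewrite -E4 -E3; ring.
by rewrite -E1 -E2; ring.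
Qed.

(** * Clausen's formula *)

Section Clausen.
Variables (R : numDomainType) (kappa lambda : R).

Definition quad : {poly R} := 'X - kappa *: 'X^2.

(** If (quad y')' = lambda y, then y ^+ 2 is killed by the third order operator
    below, the symmetric square of the second order one. *)
Definition symsq (y : {poly R}) : {poly R} :=
  (quad * ((quad * y^`())^`() - (2 * lambda) *: y))^`()
  - (2 * lambda) *: (quad * y^`()).

Lemma coef_XMderiv (P : {poly R}) i : ('X * P^`())`_i = P`_i *+ i.
Proof. by rewrite coefXM; case: i => [|i] //=; rewrite coef_deriv. Qed.

Lemma coef_quadM (P : {poly R}) i :
  (quad * P)`_i.+1 = P`_i - kappa * ('X * P)`_i.
Proof.
by rewrite /quad mulrBl -scalerAl expr2 -mulrA coefB coefZ !coefXM.
Qed.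

Lemma coef_quadMderiv (P : {poly R}) i :
  (quad * P^`())^`()`_i =
  i.+1%:R * (i.+1%:R * P`_i.+1 - kappa * (i%:R * P`_i)).
Proof.
by rewrite coef_deriv coef_quadM coef_XMderiv coef_deriv !mulr_natl.
Qed.

(** The symmetric square property with a defect: [r] is the error of [f] in the
    second order equation, and a truncated power series solution has a defect
    divisible by a high power of 'X. *)
Lemma symsq_square (f : {poly R}) (r := (quad * f^`())^`() - lambda *: f) :
  symsq (f ^+ 2) = (2 * (quad * f * r))^`() + 4 * quad * f^`() * r.
Proof.
rewrite /r /symsq -!mul_polyC; set w := quad.
rewrite !polyCM !(derivM, derivB, derivC, derivD, derivX, derivXn, deriv_exp, derivE).
rewrite !(expr1, expr2, mulr2n) /=.
ring.
Qed.

(** The operator [symsq] expressed in the variable W = quad, up to the factor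
    quad'. *)
Definition symsq_pullback (G : {poly R}) : {poly R} :=
 ('X * ((1 - (4 * kappa) *: 'X) * ('X * G^`())^`() - (2 * kappa) *: ('X * G^`())
    - (2 * lambda) *: G))^`() - (2 * lambda) *: ('X * G^`()).

(** The change of variable W = quad goes through because
    quad' ^+ 2 = 1 - 4 kappa quad and quad'' = - 2 kappa are functions of
    quad. *)
Lemma symsq_comp (G : {poly R}) :
  symsq (G \Po quad) = quad^`() * (symsq_pullback G \Po quad).
Proof.
rewrite /symsq /symsq_pullback -!mul_polyC.
rewrite !(derivM, derivB, derivC, derivD, derivX, derivXn, derivE, expr1, mulr2n,
          deriv_comp) /=.
rewrite !(comp_polyM, comp_polyB, comp_polyD, comp_polyC, comp_polyX, rmorph1,
          deriv_comp, derivM).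
rewrite /quad -!mul_polyC.
rewrite !(polyCM, polyCD, polyC0, polyC1).
ring.
Qed.

Lemma symsqB (y z : {poly R}) : symsq (y - z) = symsq y - symsq z.
Proof. by rewrite /symsq !(derivB, mulrBr, scalerBr); ring. Qed.

Lemma coef0_dvdXn n (P : {poly R}) :
  (forall i, (i < n)%N -> P`_i = 0) -> exists Q, P = Q * 'X^n.
Proof.
move=> P0; exists (drop_poly n P).
rewrite -[LHS](poly_take_drop n) [take_poly n P](_ : _ = 0) ?add0r //.
by apply/polyP=> i; rewrite coef_take_poly coef0; case: ifP => // /P0.
Qed.

(** The point 0 is regular singular with triple exponent 0: the indicial
    polynomial is k ^ 3. *)
Lemma symsq_lead (y : {poly R}) k :
  (forall j, (j <= k)%N -> y`_j = 0) ->
  (symsq y)`_k = k.+1%:R ^+ 3 * y`_k.+1.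
Proof.
move=> y0; rewrite /symsq coefB coefZ.
have wy : (quad * y^`())`_k = 0.
  case: k y0 => [|k] y0.
    by rewrite coef0M /quad coefB coefX coefZ coefXn mulr0 subr0 mul0r.
  by rewrite coef_quadM coef_XMderiv coef_deriv !y0 // !mul0rn mulr0 subr0.
rewrite wy mulr0 subr0 coef_deriv coef_quadM coefXM !coefB !coefZ.
rewrite !coef_quadMderiv (y0 k) //.
have -> : (if k == 0%N then 0 else k.-1.+1%:R * (k.-1.+1%:R * y`_k.-1.+1
     - kappa * (k.-1%:R * y`_k.-1)) - 2 * lambda * y`_k.-1) = 0.
  case: k y0 {wy} => //= k y0.
  by rewrite (y0 k.+1) // (y0 k) ?leqnSn // !(mulr0, subr0).
by rewrite -mulr_natl; ring.
Qed.

(** As the indicial polynomial has no positive integer root, a solution modulo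
    'X^n is determined by its constant term. *)
Lemma symsq_inj (y Q : {poly R}) n :
  symsq y = Q * 'X^n -> y`_0 = 0 -> forall i, (i <= n)%N -> y`_i = 0.
Proof.
move=> My y0 i; elim/ltn_ind: i => -[//|i] IHi lt_in.
have := congr1 (fun P : {poly R} => P`_i) My.
rewrite symsq_lead => [|j le_ji]; last by rewrite IHi // ltnW // (leq_ltn_trans le_ji).
rewrite coefMXn lt_in => /eqP.
by rewrite mulf_eq0 expf_eq0 /= pnatr_eq0 /= => /eqP.
Qed.

(** Clausen's formula for truncated series. The first recurrence says that the
    series of the [a k] solves the second order equation (quad y')' = lambda y,
    so its square is killed by [symsq]; the second one says that the series of
    the [b k] is killed by [symsq_pullback], so its composite with [quad] is
    killed by [symsq] too. The truncations only satisfy these equations modulo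
    'X^(N.-1), which is enough for the coefficients of index below N. *)
Theorem clausen_coef (a b : nat -> R) N :
  (forall k, k.+1%:R ^+ 2 * a k.+1 = (kappa * (k * k.+1)%:R + lambda) * a k) ->
  (forall k, k.+1%:R ^+ 3 * b k.+1
     = 2 * (2 * k).+1%:R * (kappa * (k * k.+1)%:R + lambda) * b k) ->
  b 0 = a 0 ^+ 2 ->
  forall i, (i < N)%N ->
  (\sum_(k < N) b k *: quad ^+ k)`_i = ((\poly_(k < N) a k) ^+ 2)`_i.
Proof.
move=> reca recb b0; case: N => // n i; rewrite ltnS => le_in.
set f := \poly_(k < n.+1) a k; pose G := \poly_(k < n.+1) b k.
have -> : \sum_(k < n.+1) b k *: quad ^+ k = G \Po quad.
  rewrite /G poly_def raddf_sum /=; apply: eq_bigr => k _.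
  by rewrite comp_polyZ rmorphXn /= comp_polyX.
apply/eqP; rewrite -subr_eq0 -coefB; apply/eqP.
have coef_trunc (c : nat -> R) j : (j <= n)%N -> (\poly_(k < n.+1) c k)`_j = c j.
  by move=> le_jn; rewrite coef_poly ltnS le_jn.
have [Q1 r1] : exists Q, (quad * f^`())^`() - lambda *: f = Q * 'X^n.
  apply: coef0_dvdXn => k lt_kn.
  rewrite coefB coefZ coef_quadMderiv !coef_trunc ?(ltnW lt_kn) //.
  apply/eqP; rewrite subr_eq0; apply/eqP.
  rewrite mulrBr mulrA -expr2 reca natrM; ring.
have [Q2 r2] : exists Q, symsq_pullback G = Q * 'X^n.
  apply: coef0_dvdXn => k lt_kn.
  rewrite /symsq_pullback coefB coefZ coef_deriv coefXM /= coefB coefZ coefB coefZ.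
  rewrite mulrBl mul1r coefB -scalerAl coefZ !coef_XMderiv coef_deriv coef_XMderiv.
  rewrite !coef_trunc ?(ltnW lt_kn) //.
  have -> : b k.+1 *+ k.+1 *+ k.+1 = b k.+1 * k.+1%:R ^+ 2.
    by rewrite -mulrnA -natrX mulr_natr mulnn.
  rewrite -[_ *+ k.+1]mulr_natl -[b k *+ k]mulr_natr !mulrBr.
  rewrite [k.+1%:R * (_ * k.+1%:R ^+ 2)]mulrCA -exprS mulrC.
  rewrite (recb k) -[_ *+ k]mulr_natr natrM; ring.
(* Both defects carry a power of 'X: that of f through [Q1], and that of G
   because quad is v * 'X. *)
pose v : {poly R} := 1 - kappa *: 'X.
have quadE : quad = v * 'X by rewrite /quad /v mulrBl mul1r -scalerAl.
pose E := 2 * v * f * Q1.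
apply: (@symsq_inj _ (quad^`() * (Q2 \Po quad) * v ^+ n
   - (E^`() * 'X + E * n.+1%:R + 4 * v * 'X * f^`() * Q1)) n) => //.
  rewrite symsqB symsq_comp symsq_square r1 r2 comp_polyM rmorphXn /= comp_polyX.
  have -> : 2 * (quad * f * (Q1 * 'X^n)) = E * 'X^(n.+1).
    by rewrite quadE /E exprS; ring.
  rewrite derivM derivXn /= -mulr_natr quadE exprMn [in LHS]exprS.
  by ring.
rewrite coefB expr2 coef0M !coef_trunc // -expr2 -b0 -horner_coef0.
rewrite horner_comp /quad hornerD hornerN hornerX hornerZ hornerXn expr0n mulr0 subr0.
by rewrite horner_coef0 coef_trunc // subrr.
Qed.
End Clausen.

(** * Congruences in a commutative ring *)

Section Congruences.
Variables (R : comNzRingType) (d : nat).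
Implicit Types x y z : R.

(** The witness [z] stays in R, rather than equality being taken in R / d R, so
    that x = p z can be squared to a congruence modulo p ^ 2. *)
Definition eqm x y := exists z, x = y + d%:R * z.

Lemma eqm_refl x : eqm x x.
Proof. by exists 0; rewrite mulr0 addr0. Qed.

Lemma eqm_sym x y : eqm x y -> eqm y x.
Proof. by case=> z ->; exists (- z); rewrite mulrN addrK. Qed.

Lemma eqm_trans y x z : eqm x y -> eqm y z -> eqm x z.
Proof. by move=> [u ->] [v ->]; exists (v + u); rewrite mulrDr addrA. Qed.

Lemma eqmM x y x' y' : eqm x y -> eqm x' y' -> eqm (x * x') (y * y').
Proof. by move=> [u ->] [v ->]; exists (y * v + y' * u + d%:R * u * v); ring. Qed.

Lemma eqmMl z x y : eqm x y -> eqm (z * x) (z * y).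
Proof. exact: eqmM (eqm_refl z). Qed.

Lemma eqmMr z x y : eqm x y -> eqm (x * z) (y * z).
Proof. by move=> xy; apply: eqmM (eqm_refl z). Qed.

Lemma eqm_sum (I : Type) (r : seq I) (P : pred I) (F G : I -> R) :
  (forall i, P i -> eqm (F i) (G i)) ->
  eqm (\sum_(i <- r | P i) F i) (\sum_(i <- r | P i) G i).
Proof.
move=> FG; apply: (big_ind2 eqm) => //; first exact: eqm_refl.
by move=> _ y _ y' [u ->] [v ->]; exists (u + v); ring.
Qed.

Lemma eqm_dvdn n : (d %| n)%N -> eqm n%:R 0.
Proof. by case/dvdnP=> k ->; exists k%:R; rewrite add0r mulnC natrM. Qed.

Lemma eqm_dvdz (m n : int) : (d %| m - n)%Z -> eqm m%:~R n%:~R.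
Proof.
case/dvdzP=> k E; exists k%:~R; rewrite -[m](subrK n) E addrC.
by rewrite rmorphD rmorphM mulrC.
Qed.

End Congruences.

(** * Clausen's formula modulo the square of a prime *)

Lemma size_quadX (R : numDomainType) (kappa : R) k :
  (size (quad kappa ^+ k)%R <= (2 * k).+1)%N.
Proof.
have sz_q : (size (quad kappa) <= 3)%N.
  rewrite /quad (leq_trans (size_polyD _ _)) // size_polyX size_polyN geq_max /=.
  by rewrite (leq_trans (size_scale_leq _ _)) // size_polyXn.
rewrite (leq_trans (size_poly_exp_leq _ _)) // ltnS leq_mul2r.
by apply/orP; right; case: (size _) sz_q => // -[].
Qed.

Section Congruence.
Variable p : nat.
Hypotheses (p_pr : prime p) (p_gt3 : (3 < p)%N).

Lemma dvdn_sextic_cube k : (p <= 2 * k -> k < p -> p ^ 2 %| sextic_cube k)%N.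
Proof.
move=> le_pk lt_kp; rewrite -mulnn dvdn_mul ?dvdn_central_bin ?dvdn_sextic //.
by rewrite lt_kp andbT; lia.
Qed.

(** If one index is at most p/6, then the other is at least 5p/6, where two
    factors p occur at once. *)
Lemma dvdn_sextic_pair i j : (i < p -> j < p -> p <= i + j ->
  p ^ 2 %| sextic i * sextic j)%N.
Proof.
move=> lt_ip lt_jp le_pij.
have [le_ip|lt_pi] := leqP i (p %/ 6).
  by rewrite dvdn_mull // dvdn_sextic2 //; lia.
have [le_jp|lt_pj] := leqP j (p %/ 6).
  by rewrite dvdn_mulr // dvdn_sextic2 //; lia.
by rewrite -mulnn dvdn_mul ?dvdn_sextic ?lt_pi ?lt_pj.
Qed.

Definition sextic_poly : {poly int} := \poly_(k < p) (sextic k)%:R.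

(** Truncating both series of Clausen's formula at p costs only multiples of
    p ^ 2. Below degree p the coefficients agree. From degree p on, those of
    the left side come from terms with p <= 2 * k, and those of the square from
    pairs of indices with sum at least p. *)
Lemma clausen_congr : exists G : {poly int},
  \sum_(k < p) (sextic_cube k)%:R *: quad 432%:R ^+ k
    = sextic_poly ^+ 2 + (p ^ 2)%:R *: G.
Proof.
set L := \sum_(k < p) _.
suff /polyOver_dvdzP[G defG] : L - sextic_poly ^+ 2 \is a polyOver (dvdz (p ^ 2)%:R).
  by exists G; rewrite -defG addrC subrK.
apply/polyOverP => i; have [lt_ip|le_pi] := ltnP i p.
  rewrite coefB /L (@clausen_coef int 432%:R 60%:R (fun k => (sextic k)%:R)
     (fun k => (sextic_cube k)%:R)) ?subrr ?rpred0 //.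
  - by move=> k; rewrite -natrX -!natrM sextic_rec_quad -natrD -natrM.
  - by move=> k; rewrite -natrX -!natrM sextic_cube_rec -natrD -!natrM.
rewrite coefB rpredB //.
  rewrite coef_sum rpred_sum // => k _; rewrite coefZ.
  have [lt_ki|le_ik] := ltnP (2 * k) i.
    rewrite nth_default ?mulr0 ?rpred0 //.
    exact: leq_trans (size_quadX _ _) _.
  rewrite dvdz_mulr // !natz; apply: dvdn_sextic_cube => //.
  exact: leq_trans le_ik.
rewrite expr2 coefM rpred_sum // => j _; rewrite !coef_poly.
case: ifP => [lt_jp|_]; last by rewrite mul0r rpred0.
case: ifP => [lt_ijp|_]; last by rewrite mulr0 rpred0.
rewrite -natrM !natz; apply: dvdn_sextic_pair => //.
by rewrite subnKC // -ltnS.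
Qed.

Lemma clausen_congr_eval (R : comNzRingType) (x : R) : exists z,
  \sum_(k < p) (sextic_cube k)%:R * (x * (1 - 432%:R * x)) ^+ k
    = (\sum_(k < p) (sextic k)%:R * x ^+ k) ^+ 2 + (p ^ 2)%:R * z.
Proof.
have [G clausenG] := clausen_congr; exists (map_poly intr G).[x].
have := congr1 (fun P : {poly int} => (map_poly intr P).[x]) clausenG.
rewrite /= rmorphD rmorphXn /= map_polyZ hornerD horner_exp hornerZ /= rmorph_nat.
rewrite rmorph_sum horner_sum /sextic_poly poly_def rmorph_sum horner_sum => E.
transitivity (\sum_(k < p) (map_poly intr ((sextic_cube k)%:R *: quad 432%:R ^+ k)).[x]).
  apply: eq_bigr => k _; rewrite map_polyZ rmorphXn /= rmorphB /= map_polyZ !rmorph_nat.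
  rewrite map_polyX map_polyXn hornerZ horner_exp hornerD hornerN hornerZ.
  rewrite hornerX hornerXn.
  by congr (_ * _ ^+ _); ring.
rewrite E; congr (_ ^+ 2 + _); apply: eq_bigr => k _.
by rewrite /= map_polyZ map_polyXn hornerZ hornerXn rmorph_nat.
Qed.
End Congruence.

(** * The coefficient of X^(p-1) in a power of a cubic *)

Lemma coef_XaddC_exp (R : comNzRingType) (c : R) n i :
  (('X + c%:P) ^+ n)`_i = c ^+ (n - i) *+ 'C(n, i).
Proof.
rewrite addrC exprDn coef_sum.
have [le_in|lt_ni] := leqP i n; last first.
  rewrite bin_small // big1 // => j _.
  rewrite coefMn -polyC_exp coefCM coefXn gtn_eqF ?mulr0 ?mul0rn //.
  by rewrite (leq_ltn_trans _ lt_ni) // -ltnS.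
rewrite (bigD1 (Ordinal (le_in : i < n.+1)%N)) //= big1 ?addr0 => [|j ne_ji].
  by rewrite coefMn -polyC_exp coefCM coefXn eqxx mulr1.
rewrite coefMn -polyC_exp coefCM coefXn (_ : (i == j) = false) ?mulr0 ?mul0rn //.
by apply: contraNF ne_ji => /eqP E; apply/eqP/val_inj.
Qed.

Definition cubic (R : nzRingType) (m n : R) : {poly R} := 'X^3 + m *: 'X + n%:P.

Lemma size_cubic (R : nzRingType) (m n : R) : (size (cubic m n) <= 4)%N.
Proof.
rewrite /cubic (leq_trans (size_polyD _ _)) // geq_max.
rewrite (leq_trans (size_polyC_leq1 _)) // andbT.
rewrite (leq_trans (size_polyD _ _)) // geq_max size_polyXn /=.
by rewrite (leq_trans (size_scale_leq _ _)) // size_polyX.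
Qed.

Lemma size_cubic_exp (R : nzRingType) (m n : R) h :
  (size (cubic m n ^+ h) <= (3 * h).+1)%N.
Proof.
rewrite (leq_trans (size_poly_exp_leq _ _)) // ltnS leq_mul2r.
by apply/orP; right; have := size_cubic m n; lia.
Qed.

Lemma coef_trinomial_exp (R : comNzRingType) (b e : R) h :
  (('X^2 * ('X + b%:P) + e%:P) ^+ h)`_h.*2 =
  \sum_(l < h.+1) ('C(h, l) * 'C(h - l, 2 * l))%:R * (b ^+ (h - l - 2 * l) * e ^+ l).
Proof.
rewrite exprDn coef_sum; apply: eq_bigr => l _.
rewrite coefMn -polyC_exp coefMC exprMn -exprM coefXnM.
have le_lh : (l <= h)%N by rewrite -ltnS.
rewrite ifN; last by lia.
rewrite (_ : h.*2 - 2 * (h - l) = 2 * l)%N; last by lia.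
rewrite coef_XaddC_exp -[_ *+ 'C(h, l)]mulr_natr -[_ *+ 'C(_, _)]mulr_natr natrM; ring.
Qed.

Section Hasse.
Variables (p h : nat).
Hypotheses (p_pr : prime p) (p_gt3 : (3 < p)%N) (pE : p = h.*2.+1).

Lemma dvdn_bin_pred j : (p <= j < p + h.*2)%N -> (p %| 'C(j, h.*2))%N.
Proof.
move=> /andP[le_pj lt_j].
have := @bin_fact j h.*2; rewrite ltnW => [/(_ isT) E|]; last by lia.
have := prime_dvd_fact j p_pr; rewrite le_pj -E !Euclid_dvdM //.
by rewrite !prime_dvd_fact // orbA; case: (p %| _)%N => //=; lia.
Qed.

(** Translation preserves the coefficient of 'X^(p.-1) modulo p for
    polynomials of degree less than 2 (p - 1): the contributions of the higher
    monomials are the binomials of [dvdn_bin_pred]. Over F_p this is the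
    invariance of the sum of all values of Q. *)
Lemma coef_translate (R : comNzRingType) (c : R) (Q : {poly R}) :
  (size Q <= h.*2 + p)%N -> eqm p (Q \Po ('X + c%:P))`_(h.*2) Q`_(h.*2).
Proof.
move=> szQ; have -> : Q`_h.*2 = \sum_(i < size Q) (Q`_i *: 'X^i)`_h.*2.
  by rewrite -coef_sum -poly_def coefK.
rewrite comp_polyE coef_sum.
apply: eqm_sum => i _; rewrite !coefZ coef_XaddC_exp coefXn; apply: eqmMl.
have lt_i : (i < p + h.*2)%N by have := ltn_ord i; lia.
case: (ltngtP i h.*2) => [lt_ih|lt_hi|->].
- by rewrite bin_small //; apply: eqm_refl.
- rewrite -mulr_natr -[X in eqm _ _ X](mulr0 (c ^+ (i - h.*2))).
  by apply: eqmMl; apply: eqm_dvdn; apply: dvdn_bin_pred; lia.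
by rewrite subnn binn; apply: eqm_refl.
Qed.

(** Modulo p one has h = -1/2, and (-4)^j binom(-1/2, j) = binom(2j, j). *)
Lemma half_bin_congr j : (j <= h)%N ->
  (p%:Z %| (('C(h, j))%:R * (-4) ^+ j - ('C(2 * j, j))%:R)%R)%Z.
Proof.
elim: j => [|j IHj] lt_jh; first by rewrite !bin0 subrr dvdz0.
have cop : coprimez p j.+1 by rewrite coprimezE /= prime_coprime // gtnNdvd //; lia.
rewrite -(Gauss_dvdzr _ cop).
have E1 : j.+1%:Z * ('C(h, j.+1))%:R = (h%:R - j%:R) * ('C(h, j))%:R.
  by rewrite -[j.+1%:Z]natz -natrM mul_bin_left natrM natrB // ltnW.
have E2 : j.+1%:Z * ('C(2 * j.+1, j.+1))%:R = 2 * (2 * j%:R + 1) * ('C(2 * j, j))%:R.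
  by rewrite -[j.+1%:Z]natz -natrM central_bin_rec !natrM -[(2 * j).+1]addn1 natrD natrM.
have {}IHj := IHj (ltnW lt_jh).
have -> : j.+1%:Z * (('C(h, j.+1))%:R * (-4) ^+ j.+1 - ('C(2 * j.+1, j.+1))%:R) =
   2 * (2 * j%:R + 1) * (('C(h, j))%:R * (-4) ^+ j - ('C(2 * j, j))%:R)
   - p%:Z * (2 * (-4) ^+ j * ('C(h, j))%:R).
  rewrite mulrBr mulrA E1 E2 -[p%:Z]natz pE -[h.*2.+1]addn1 -mul2n natrD natrM exprS.
  by ring.
by apply: rpredB; [apply: dvdz_mull | apply: dvdz_mulr].
Qed.

(** When h < 3 * l the left side vanishes, and then l > p/6 so that
    [sextic l] is a multiple of p. *)
Lemma trinomial_sextic (R : comNzRingType) (b x : R) l : (l < p)%N ->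
  eqm p (('C(h, l) * 'C(h - l, 2 * l))%:R *
           (b ^+ (h - l - 2 * l) * ((- 4 * b) ^+ 3 * x) ^+ l))
        (b ^+ h * ((sextic l)%:R * x ^+ l)).
Proof.
move=> lt_lp; have [le_lh|lt_hl] := leqP (3 * l) h; last first.
  rewrite [in 'C(h - l, _)]bin_small; last by lia.
  rewrite muln0 mul0r; apply: eqm_sym.
  rewrite -[X in eqm _ _ X](mulr0 (b ^+ h)); apply: eqmMl.
  rewrite -[X in eqm _ _ X](mul0r (x ^+ l)); apply: eqmMr.
  apply/eqm_dvdn/dvdn_sextic => //; rewrite lt_lp andbT.
  rewrite ltn_divLR // mulnC.
  have : (p != 6 * l)%N.
    apply/eqP=> E; have := dvdn_prime2 (isT : prime 2) p_pr.
    have -> : (2 %| p)%N by rewrite E (dvdn_mulr l (isT : 2 %| 6)%N).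
    by move/esym/eqP; lia.
  by lia.
have -> : b ^+ h * ((sextic l)%:R * x ^+ l)
   = (('C(2 * (3 * l), 3 * l))%:R * ('C(3 * l, l))%:R) * (b ^+ h * x ^+ l).
  by rewrite /sextic (_ : 2 * (3 * l) = 6 * l)%N ?natrM; [ring | lia].
have -> : ('C(h, l) * 'C(h - l, 2 * l))%:R *
            (b ^+ (h - l - 2 * l) * ((-4 * b) ^+ 3 * x) ^+ l)
   = (('C(h, 3 * l))%:R * (-4) ^+ (3 * l) * ('C(3 * l, l))%:R) * (b ^+ h * x ^+ l) :> R.
  rewrite trinomial_bin // natrM exprMn -exprM exprMn.
  have -> : b ^+ h = b ^+ (h - l - 2 * l) * b ^+ (3 * l).
    by rewrite -exprD; congr (_ ^+ _); lia.
  ring.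
apply/eqmMr/eqmMr.
have := eqm_dvdz R (half_bin_congr le_lh).
by rewrite rmorphM rmorphXn !rmorph_nat rmorphN rmorph_nat.
Qed.

(** The translation by c turns the cubic into X^2 (X + 3c) + e, where
    e = (-12 c)^3 x is the value of the cubic at its critical point c; with no
    linear term left, the coefficient is a sum over a single index. *)
Theorem hasse_coef (R : comNzRingType) (c x : R) :
  eqm p (cubic (- (3 * c ^+ 2)) (2 * c ^+ 3 + (- 4 * (3 * c)) ^+ 3 * x) ^+ h)`_h.*2
        ((3 * c) ^+ h * \sum_(l < p) (sextic l)%:R * x ^+ l).
Proof.
set e := (- 4 * (3 * c)) ^+ 3 * x; set Q := _ ^+ h.
apply: (eqm_trans (eqm_sym (coef_translate c _))).
  by rewrite (leq_trans (size_cubic_exp _ _ _)) //; lia.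
have -> : Q \Po ('X + c%:P) = ('X^2 * ('X + (3 * c)%:P) + e%:P) ^+ h.
  rewrite rmorphXn /= /cubic; congr (_ ^+ h).
  rewrite !comp_polyD comp_polyZ comp_polyC rmorphXn /= comp_polyX -mul_polyC.
  rewrite /e !(polyCD, polyCN, polyCM, polyC1).
  ring.
pose term l := ('C(h, l) * 'C(h - l, 2 * l))%:R * ((3 * c) ^+ (h - l - 2 * l) * e ^+ l).
rewrite coef_trinomial_exp (big_ord_widen p term); last by lia.
rewrite big_mkcond mulr_sumr /=; apply: eqm_sum => l _.
case: ltnP => [_|lt_hl]; first exact: trinomial_sextic.
apply: eqm_trans (trinomial_sextic (3 * c) x (ltn_ord l)).
by rewrite bin_small // mul0n mul0r; apply: eqm_refl.
Qed.
End Hasse.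

(** * Character sums over a finite field *)

Section OddFiniteField.
Variables (F : finFieldType) (h : nat).
Hypotheses (h_gt0 : (0 < h)%N) (cardF : #|F| = h.*2.+1).

Lemma expf_unit (y : F) : y != 0 -> y ^+ h.*2 = 1.
Proof.
by move=> nz_y; apply: (mulfI nz_y); rewrite -exprS -cardF expf_card mulr1.
Qed.

Lemma finField_prim_root : exists g : F, (h.*2).-primitive_root g.
Proof.
have n_gt0 : (0 < h.*2)%N by rewrite double_gt0.
have /hasP[g _ prim_g] : has (h.*2).-primitive_root (enum (predC1 (0 : F))).
  apply: has_prim_root; rewrite ?enum_uniq -?cardE ?cardC1 ?cardF //.
  by apply/allP=> y; rewrite mem_enum unity_rootE => /expf_unit->.
by exists g.
Qed.

Lemma euler_criterion (y : F) : y ^+ h =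
  (if y == 0 then 0 else if [exists z, z ^+ 2 == y] then 1 else -1).
Proof.
case: eqP => [->|/eqP nz_y]; first by rewrite expr0n eqn0Ngt h_gt0.
case: ifP => [/existsP[z /eqP Ez]|no_root].
  have nz_z : z != 0 by apply: contraNneq nz_y => z0; rewrite -Ez z0 expr0n.
  by rewrite -Ez -exprM mul2n expf_unit.
have /eqP : (y ^+ h) ^+ 2 = 1 ^+ 2 by rewrite -exprM muln2 expf_unit // expr1n.
rewrite eqf_sqr => /orP[/eqP yh1|/eqP //].
have [g prim_g] := finField_prim_root.
have [[k _] /= Ek] := prim_rootP prim_g (expf_unit nz_y).
have : (h.*2 %| k * h)%N by rewrite (prim_order_dvd prim_g) exprM -Ek yh1.
rewrite -mul2n dvdn_pmul2r // => /dvdnP[i Ei].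
case/existsP: no_root; exists (g ^+ i).
by rewrite -exprM -Ei Ek.
Qed.

(** Multiplication of the summation variable by a primitive root g multiplies
    the sum by g ^+ j, which is not 1 unless j is 0 or h.*2. In these two cases
    all nonzero y contribute 1, but y = 0 contributes only when j = 0. *)
Lemma power_sum j : (j < h.*2.*2)%N ->
  \sum_(y : F) y ^+ j = (if j == h.*2 then -1 else 0).
Proof.
move=> lt_j.
(* The sum of all y is invariant under y -> y + 1. *)
have sum1 : \sum_(y : F) (1 : F) = 0.
  apply: (addrI (\sum_(y : F) y)); rewrite addr0 -big_split /=.
  by rewrite [RHS](reindex_inj (addIr 1)).
have [->|nz_j] := eqVneq j 0%N; first by rewrite ifN // eq_sym -lt0n double_gt0.
case: eqP => [->|/eqP ne_j].
  rewrite (bigD1 0) //= expr0n double_eq0 eqn0Ngt h_gt0 add0r.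
  rewrite (eq_bigr (fun=> 1)) => [|y /expf_unit //].
  by apply: (addrI 1); rewrite subrr -[RHS]sum1 [RHS](bigD1 0).
have [g prim_g] := finField_prim_root.
have nz_g : g != 0 by rewrite (prim_root_eq0 prim_g) double_eq0 -lt0n.
have gj : g ^+ j != 1.
  rewrite -(prim_order_dvd prim_g); apply/negP => /dvdnP[i E].
  move: ne_j nz_j lt_j; rewrite E.
  by case: i {E} => [|[|i]]; rewrite ?mul0n ?mul1n ?eqxx //; lia.
apply/eqP; have /eqP : \sum_(y : F) y ^+ j = g ^+ j * \sum_(y : F) y ^+ j.
  rewrite [LHS](reindex_inj (mulfI nz_g)) mulr_sumr.
  by apply: eq_bigr => y _; rewrite exprMn.
by rewrite -subr_eq0 -{1}[\sum_y _]mul1r -mulrBl mulf_eq0 subr_eq0 eq_sym (negPf gj).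
Qed.

Lemma sum_horner (Q : {poly F}) : (size Q <= h.*2.*2)%N ->
  \sum_(y : F) Q.[y] = - Q`_h.*2.
Proof.
move=> szQ; under eq_bigr do rewrite horner_coef.
rewrite exchange_big /=.
under eq_bigr => i _ do rewrite -mulr_sumr power_sum ?(leq_trans (ltn_ord i)) //.
have [lt_hQ|le_Qh] := ltnP h.*2 (size Q); last first.
  rewrite nth_default // oppr0 big1 // => i _.
  by rewrite ltn_eqF ?mulr0 // (leq_trans (ltn_ord i)).
rewrite (bigD1 (Ordinal lt_hQ)) //= eqxx mulrN1 big1 ?addr0 // => i.
by rewrite -val_eqE /= => /negPf->; rewrite mulr0.
Qed.
End OddFiniteField.

(** * The ring of p-integral rationals *)

Lemma RpP p (x : rat) :
  reflect (exists n d : int, coprime `|d| p /\ x * d%:~R = n%:~R) (x \in Rp p).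
Proof.
apply: (iffP idP) => [x_p|[n [d [cop_dp Ex]]]].
  by exists (numq x), (denq x); rewrite numqE.
have E : numq x * d = n * denq x.
  by apply: (@intr_inj rat); rewrite !rmorphM /= -Ex numqE mulrAC.
apply: coprime_dvdl cop_dp; rewrite -(@Gauss_dvdr _ `|numq x|).
  by rewrite -abszM E abszM dvdn_mull.
by rewrite coprime_sym coprime_num_den.
Qed.

Fact Rp_subring_closed p : subring_closed (Rp p).
Proof.
split=> [|x y|x y].
- by apply/RpP; exists 1, 1; rewrite coprime1n mulr1.
- move=> /RpP[n [d [cd Ex]]] /RpP[n' [d' [cd' Ey]]]; apply/RpP.
  exists (n * d' - n' * d), (d * d'); rewrite abszM coprimeMl cd cd'; split=> //.
  by rewrite rmorphB !rmorphM /= -Ex -Ey; ring.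
move=> /RpP[n [d [cd Ex]]] /RpP[n' [d' [cd' Ey]]]; apply/RpP.
exists (n * n'), (d * d'); rewrite abszM coprimeMl cd cd'; split=> //.
by rewrite !rmorphM /= -Ex -Ey; ring.
Qed.

HB.instance Definition _ p :=
  GRing.isSubringClosed.Build rat (Rp p) (Rp_subring_closed p).

Record localized p := Localized { loc_val :> rat; _ : loc_val \in Rp p }.
HB.instance Definition _ p := [isSub for @loc_val p].
HB.instance Definition _ p := [Choice of localized p by <:].
HB.instance Definition _ p := [SubChoice_isSubComNzRing of localized p by <:].

Section Residue.
Variables (p : nat) (p_pr : prime p).

Lemma intr_Fp_eq0 (n : int) : (n%:~R == 0 :> 'F_p) = (p %| `|n|)%N.
Proof.
case: n => n; first by rewrite (dvdn_pcharf (pchar_Fp p_pr)).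
by rewrite NegzE rmorphN oppr_eq0 (dvdn_pcharf (pchar_Fp p_pr)).
Qed.

(** The residue can be computed from any fraction, not only from the one in
    lowest terms; this makes it a ring morphism. *)
Lemma residue_eq (x : rat) (n d : int) : x \in Rp p -> x * d%:~R = n%:~R ->
  Rp_residue p x * d%:~R = n%:~R.
Proof.
move=> x_p Ex.
have nz_d : (denq x)%:~R != 0 :> 'F_p.
  rewrite intr_Fp_eq0 -prime_coprime // coprime_sym; exact: x_p.
have E : numq x * d = n * denq x.
  by apply: (@intr_inj rat); rewrite !rmorphM /= -Ex numqE mulrAC.
apply: (mulIf nz_d); rewrite /Rp_residue /ratr mulrAC divfK //.
by rewrite -!rmorphM E.
Qed.

(** The proof that p is prime is an argument because the map is a ring
    morphism only then. *)
Definition residue of prime p := fun x : localized p => Rp_residue p (loc_val x).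

Lemma Rp_fraction (x : localized p) : exists n d : int,
  d%:~R != 0 :> 'F_p /\ loc_val x * d%:~R = n%:~R.
Proof.
have /RpP[n [d [cop_dp Ex]]] := valP x.
by exists n, d; rewrite intr_Fp_eq0 -prime_coprime // coprime_sym.
Qed.

Fact residue_is_zmod_morphism : zmod_morphism (residue p_pr).
Proof.
move=> x y; have [n [d [nz_d Ex]]] := Rp_fraction x.
have [n' [d' [nz_d' Ey]]] := Rp_fraction y.
have Exy : val (x - y) * (d * d')%:~R = (n * d' - n' * d)%:~R.
  by rewrite !(rmorphB, rmorphM) /= -Ex -Ey; ring.
apply: (mulIf (mulf_neq0 nz_d nz_d')); rewrite -rmorphM.
rewrite (residue_eq (valP _) Exy) !(rmorphB, rmorphM) /=.
by rewrite -(residue_eq (valP _) Ex) -(residue_eq (valP _) Ey) /residue; ring.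
Qed.

Fact residue_is_monoid_morphism : monoid_morphism (residue p_pr).
Proof.
split=> [|x y]; first exact: (ratr_nat _ 1).
have [n [d [nz_d Ex]]] := Rp_fraction x.
have [n' [d' [nz_d' Ey]]] := Rp_fraction y.
have Exy : val (x * y) * (d * d')%:~R = (n * n')%:~R.
  by rewrite !rmorphM /= -Ex -Ey; ring.
apply: (mulIf (mulf_neq0 nz_d nz_d')); rewrite -rmorphM.
rewrite (residue_eq (valP _) Exy) !rmorphM /=.
by rewrite -(residue_eq (valP _) Ex) -(residue_eq (valP _) Ey) /residue; ring.
Qed.

HB.instance Definition _ :=
  GRing.isZmodMorphism.Build (localized p) 'F_p (residue p_pr)
    residue_is_zmod_morphism.
HB.instance Definition _ :=
  GRing.isMonoidMorphism.Build (localized p) 'F_p (residue p_pr)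
    residue_is_monoid_morphism.

Lemma residue_eq0 (x : localized p) : residue p_pr x = 0 -> eqm p x 0.
Proof.
have /RpP[n [d [cop_dp]]] := valP x; rewrite -[val x]/(loc_val x) => Ex.
move=> x0; have /eqP := residue_eq (valP x) Ex.
rewrite -/(residue p_pr x) x0 mul0r eq_sym intr_Fp_eq0 => dv_pn.
have /dvdzP[q En] : (p%:Z %| n)%Z by [].
have p_neq0 : p%:R != 0 :> rat by rewrite pnatr_eq0 -lt0n prime_gt0.
have q_p : loc_val x / p%:R \in Rp p.
  apply/RpP; exists q, d; split=> //.
  by rewrite mulrAC Ex En rmorphM /= mulfK.
exists (Localized q_p); apply: val_inj; rewrite add0r rmorphM rmorph_nat /=.
by rewrite mulrC divfK.
Qed.

Lemma residue_eqm (x y : localized p) : residue p_pr x = residue p_pr y -> eqm p x y.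
Proof.
move=> Exy; have [|z Ez] := @residue_eq0 (x - y); first by rewrite rmorphB /= Exy subrr.
by exists z; rewrite -[x](subrK y) Ez add0r addrC.
Qed.

Lemma Rp_unit (x : localized p) : residue p_pr x != 0 -> exists y, x * y = 1.
Proof.
have /RpP[n [d [cop_dp]]] := valP x; rewrite -[val x]/(loc_val x) => Ex.
move=> nz_x; have E := residue_eq (valP x) Ex.
have nz_d : d%:~R != 0 :> 'F_p by rewrite intr_Fp_eq0 -prime_coprime // coprime_sym.
have nz_n : n%:~R != 0 :> 'F_p by rewrite -E mulf_neq0.
have nz_vx : loc_val x != 0.
  apply: contraNneq nz_x => vx0; rewrite (_ : x = 0) ?rmorph0 //; exact: val_inj.
have V_p : (loc_val x)^-1 \in Rp p.
  apply/RpP; exists d, n; split.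
    by rewrite coprime_sym prime_coprime // -intr_Fp_eq0.
  by rewrite -Ex mulKf.
by exists (Localized V_p); apply: val_inj; rewrite rmorphM rmorph1 /= mulfV.
Qed.
End Residue.

Section CharSum.
Variables (p h : nat).
Hypotheses (p_pr : prime p) (p_gt3 : (3 < p)%N) (pE : p = h.*2.+1).
Let h_gt0 : (0 < h)%N. Proof. by move: p_gt3; rewrite pE; case: h. Qed.
Let cardFp : #|'F_p| = h.*2.+1. Proof. by rewrite card_Fp. Qed.

Lemma legendre_residue (a : rat) : (legendre p a)%:~R = Rp_residue p a ^+ h.
Proof.
rewrite (euler_criterion h_gt0 cardFp) /legendre; case: eqP => // _.
by case: ifP => // _; rewrite rmorphN.
Qed.

Lemma legendre_eqm (a : localized p) : eqm p ((legendre p (loc_val a))%:~R) (a ^+ h).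
Proof.
by apply: (residue_eqm (p_pr := p_pr)); rewrite rmorph_int legendre_residue rmorphXn.
Qed.

Lemma coef_map_cubic (R S : comNzRingType) (f : {rmorphism R -> S}) (m n : R) i :
  (cubic (f m) (f n) ^+ h)`_i = f (cubic m n ^+ h)`_i.
Proof.
rewrite -coef_map rmorphXn /= /cubic !rmorphD /= map_polyZ map_polyXn map_polyX.
by rewrite map_polyC.
Qed.

(** By Euler's criterion the character sum becomes the sum over F_p of the
    values of a polynomial of degree 3 h < 2 (p - 1). *)
Lemma cubic_char_sum_eqm (m n : localized p) :
  eqm p ((cubic_char_sum p (loc_val m) (loc_val n))%:~R) (- (cubic m n ^+ h)`_h.*2).
Proof.
apply: (residue_eqm (p_pr := p_pr)); rewrite rmorph_int rmorphN -coef_map_cubic.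
rewrite -(sum_horner h_gt0 cardFp); last first.
  by rewrite (leq_trans (size_cubic_exp _ _ _)) //; lia.
rewrite /cubic_char_sum -[X in index_iota 0 X](Fp_cast p_pr) big_mkord rmorph_sum.
apply: eq_bigr => x _; rewrite /= legendre_residue.
have -> : (x%:R ^+ 3 + loc_val m * x%:R + loc_val n) = loc_val (x%:R ^+ 3 + m * x%:R + n).
  by rewrite -[RHS]/(val _) !rmorphD rmorphXn rmorphM !rmorph_nat.
rewrite -[Rp_residue _ _]/(residue p_pr _) horner_exp /cubic !hornerE.
by rewrite !rmorphD rmorphXn rmorphM !rmorph_nat natr_Zp.
Qed.
End CharSum.

(** * Adjoining a square root *)

(** A[X] / (X^2 - d) is free over A with basis 1, X, so congruences between
    elements of A can be read off on the constant coefficients. *)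
Lemma sqrt_extension (A : comNzRingType) (d : A) :
  exists (B : comNzRingType) (f : {rmorphism A -> B}) (c : B),
    c ^+ 2 = f d /\ forall q x y, eqm q (f x) (f y) -> eqm q x y.
Proof.
pose P : {poly A} := 'X^2 - d%:P.
have P_monic : P \is monic by rewrite monicXnsubC.
have szP : size P = 3 by rewrite size_XnsubC.
have mkP : mk_monic P = P by rewrite /mk_monic szP P_monic.
exists {poly %/ P}, (qpolyC P), (in_qpoly P 'X); split=> [|q x y [z E]].
  have inP : in_qpoly P P = 0 by apply: val_inj; rewrite /= mkP Pdiv.RingMonic.rmodpp.
  rewrite -rmorphXn /= -[X in in_qpoly P X](subrK d%:P) in_qpolyD -/P inP add0r.
  apply: val_inj; rewrite /= mkP Pdiv.CommonRing.rmodp_small // szP size_polyC.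
  by case: eqP.
exists (val z)`_0.
have := congr1 (fun w : {poly %/ P} => (val w)`_0) E.
rewrite mulr_natl raddfD raddfMn /= coefD coefMn !coefC /= => ->.
by rewrite mulr_natl.
Qed.

Definition sextic_cube_sum (A : comNzRingType) N (u : A) : A :=
  \sum_(k < N) (sextic_cube k)%:R * u ^+ k.

Lemma sextic_cube_sum_trunc (p : nat) (A : comNzRingType) (u : A) :
  prime p -> (3 < p)%N ->
  eqm p (sextic_cube_sum p u) (sextic_cube_sum (p %/ 6).+1 u).
Proof.
move=> p_pr p_gt3.
have le_p6 : ((p %/ 6).+1 <= p)%N by lia.
rewrite /sextic_cube_sum.
rewrite (big_ord_widen _ (fun k => (sextic_cube k)%:R * u ^+ k) le_p6).
rewrite [X in eqm _ _ X]big_mkcond; apply: eqm_sum => k _.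
case: ltnP => [_|lt_k]; first exact: eqm_refl.
rewrite -[X in eqm _ _ X](mul0r (u ^+ k)); apply/eqmMr/eqm_dvdn.
by rewrite dvdn_mull // dvdn_sextic // lt_k ltn_ord.
Qed.

Section Main.
Variables (p h : nat).
Hypotheses (p_pr : prime p) (p_gt3 : (3 < p)%N) (pE : p = h.*2.+1).

(** The case where m = - 3 c ^+ 2 with c a unit; [ci] is the inverse of c and
    [i] is 1/12. Then H is congruent to (3c)^h F with F the truncated series of
    the [sextic l] at x, and x (1 - 432 x) = u turns F ^+ 2 into
    [sextic_cube_sum p u] modulo p ^ 2. If p divides H it divides F, because
    3 c is a unit, and then p ^ 2 divides F ^+ 2. *)
Lemma hasse_clausen_split (B : comNzRingType) (m n c ci i : B)
  (u := 3 * i ^+ 4 * (4 - n ^+ 2 * (ci ^+ 2) ^+ 3))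
  (H := (cubic m n ^+ h)`_h.*2) :
  - (3 * c ^+ 2) = m -> c * ci = 1 -> 12%:R * i = 1 ->
  eqm p (H ^+ 2) ((- 3 * m) ^+ h * sextic_cube_sum p u)
  /\ (eqm p H 0 -> eqm (p ^ 2) (sextic_cube_sum p u) 0).
Proof.
move=> mE cK iK.
(* x is (2 c^3 - n) / (12 c)^3, so that [hasse_coef] yields the cubic with
   constant term n. *)
pose x := i ^+ 3 * (2 - n * ci ^+ 3).
have nE : 2 * c ^+ 3 + (- 4 * (3 * c)) ^+ 3 * x = n.
  have -> : (- 4 * (3 * c)) ^+ 3 * x =
            - (12%:R * i) ^+ 3 * (2 * c ^+ 3 - n * (c * ci) ^+ 3).
    by rewrite /x; ring.
  by rewrite iK cK; ring.
have uE : x * (1 - 432%:R * x) = u.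
  have e1 : 432%:R * x = 3 * i * (2 - n * ci ^+ 3).
    transitivity (3 * (12%:R * i) ^+ 2 * i * (2 - n * ci ^+ 3)).
      by rewrite /x; ring.
    by rewrite iK; ring.
  rewrite e1 -[X in X - _]iK /x /u; ring.
pose F := \sum_(l < p) (sextic l)%:R * x ^+ l.
have HE : eqm p H ((3 * c) ^+ h * F).
  by have := hasse_coef p_pr p_gt3 pE c x; rewrite mE nE.
have [z SE] : eqm (p ^ 2) (sextic_cube_sum p u) (F ^+ 2).
  by have := clausen_congr_eval p_pr p_gt3 x; rewrite uE.
split.
  apply: (eqm_trans (eqmM HE HE)).
  have -> : (3 * c) ^+ h * F * ((3 * c) ^+ h * F) = (- 3 * m) ^+ h * F ^+ 2.
    rewrite [F ^+ 2]expr2 mulrACA -exprMn; congr (_ ^+ _ * _); rewrite -mE; ring.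
  apply: eqmMl; exists (- (p%:R * z)); rewrite SE -mulnn natrM; ring.
move=> H0; have [y Fy] : eqm p F 0.
  have -> : F = (4 * ci * i) ^+ h * ((3 * c) ^+ h * F).
    rewrite mulrA -exprMn (_ : 4 * ci * i * (3 * c) = c * ci * (12%:R * i)); last by ring.
    by rewrite cK iK mulr1 expr1n mul1r.
  rewrite -[X in eqm _ _ X](mulr0 ((4 * ci * i) ^+ h)); apply: eqmMl.
  exact: eqm_trans (eqm_sym HE) H0.
exists (y ^+ 2 + z); rewrite SE Fy -mulnn natrM; ring.
Qed.

(** The general case reduces to the previous one by adjoining a square root c
    of - m / 3; in u only c ^+ 2 occurs, so the conclusions concern elements of
    A and descend. *)
Theorem hasse_clausen (A : comNzRingType) (m n mi i : A)
  (u := 3 * i ^+ 4 * (4 + 27%:R * n ^+ 2 * mi ^+ 3))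
  (H := (cubic m n ^+ h)`_h.*2) :
  m * mi = 1 -> 12%:R * i = 1 ->
  eqm p (H ^+ 2) ((- 3 * m) ^+ h * sextic_cube_sum p u)
  /\ (eqm p H 0 -> eqm (p ^ 2) (sextic_cube_sum p u) 0).
Proof.
move=> mK iK; have [B [f [c [cE reflect_f]]]] := sqrt_extension (- (4 * i * m)).
have mE : - (3 * c ^+ 2) = f m.
  rewrite cE -[3](rmorph_nat f 3) -rmorphM -rmorphN.
  rewrite (_ : - (3%:R * _) = 12%:R * i * m); last by ring.
  by rewrite iK mul1r.
pose ci := c * f (- (3 * mi)).
have cK : c * ci = 1.
  rewrite mulrA -expr2 cE -rmorphM (_ : _ * _ = (12%:R * i) * (m * mi)); last by ring.
  by rewrite iK mK mulr1 rmorph1.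
have iKB : 12%:R * f i = 1 by rewrite -(rmorph_nat f 12) -rmorphM iK rmorph1.
have ci2 : ci ^+ 2 = f (- (3 * mi)).
  by rewrite expr2 {1}/ci mulrAC cK mul1r.
have [] := @hasse_clausen_split B (f m) (f n) c ci (f i) mE cK iKB.
rewrite ci2 coef_map_cubic.
have -> : 3 * f i ^+ 4 * (4 - f n ^+ 2 * f (- (3 * mi)) ^+ 3) = f u.
  by rewrite /u !(rmorphM, rmorphD, rmorphXn, rmorphN, rmorph_nat); ring.
have -> : sextic_cube_sum p (f u) = f (sextic_cube_sum p u).
  rewrite rmorph_sum; apply: eq_bigr => k _.
  by rewrite /= rmorphM rmorphXn rmorph_nat.
move=> E1 E2; split=> [|H0]; apply: reflect_f.
  rewrite rmorphXn [f (_ * sextic_cube_sum _ _)]rmorphM rmorphXn rmorphM.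
  by rewrite rmorphN rmorph_nat.
rewrite rmorph0; apply: E2; case: H0 => z Hz; exists (f z).
by rewrite -/H Hz rmorphD rmorph0 rmorphM rmorph_nat.
Qed.

End Main.

(** * The congruences for rational coefficients *)

Lemma eqm_Rp_congr p q (x y : localized p) :
  eqm q x y -> Rp_congr p q (loc_val x) (loc_val y).
Proof.
case=> z Exy; split; [exact: (valP x) | exact: (valP y) | ].
exists (loc_val z); first exact: (valP z).
by rewrite Exy -[loc_val (y + _)]/(val _) rmorphD rmorphM rmorph_nat addrC addKr.
Qed.

Lemma loc_val_binom_sum p N (u : localized p) :
  binom_sum N (loc_val u) = loc_val (sextic_cube_sum N u).
Proof.
rewrite /binom_sum big_mkord -[RHS]/(val _) rmorph_sum; apply: eq_bigr => k _.
by rewrite [RHS]rmorphM rmorphXn rmorph_nat /= -mulnA.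
Qed.

Theorem theorem4p2 (p : nat) (m n : rat) :
  prime p -> (3 < p)%N ->
  m \in Rp p -> n \in Rp p -> ~ Rp_congr p p m 0 ->
  let u : rat := (4 * m ^+ 3 + 27 * n ^+ 2) / (12 ^+ 3 * (4 * m ^+ 3)) in
  [/\ u \in Rp p,
      Rp_congr p p ((cubic_char_sum p m n)%:~R ^+ 2)
                   ((legendre p (- 3 * m))%:~R * binom_sum p u),
      Rp_congr p p ((legendre p (- 3 * m))%:~R * binom_sum p u)
                   ((legendre p (- 3 * m))%:~R * binom_sum (p %/ 6).+1 u)
    & cubic_char_sum p m n = 0 -> Rp_congr p (p ^ 2) (binom_sum p u) 0].
Proof.
move=> p_pr p_gt3 m_p n_p m_nz.
have [h pE] : exists h, p = h.*2.+1.
  exists p./2; have [|p_odd] := even_prime p_pr; first by lia.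
  by rewrite -[LHS]odd_double_half p_odd.
pose M := Localized m_p; pose N := Localized n_p.
have [Mi MK] : exists y, M * y = 1.
  apply: (Rp_unit (p_pr := p_pr)); apply/eqP => /residue_eq0/eqm_Rp_congr.
  by rewrite -[loc_val 0]/(val _) rmorph0.
have [i iK] : exists y, 12%:R * y = 1 :> localized p.
  apply: (Rp_unit (p_pr := p_pr)); rewrite rmorph_nat -(dvdn_pcharf (pchar_Fp p_pr)).
  rewrite (_ : 12 = 2 * 2 * 3)%N // !Euclid_dvdM // !dvdn_prime2 //.
  by lia.
pose U := 3 * i ^+ 4 * (4 + 27%:R * N ^+ 2 * Mi ^+ 3).
have m_neq0 : m != 0.
  apply: contra_not_neq m_nz => ->; split; rewrite ?rpred0 //.
  by exists 0; rewrite ?rpred0 // subrr mulr0.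
have valMi : loc_val Mi = m^-1.
  apply: (mulfI m_neq0); rewrite mulfV //.
  by have := congr1 val MK; rewrite rmorphM rmorph1.
have vali : loc_val i = 12^-1.
  have nz12 : (12 != 0 :> rat) by [].
  apply: (mulfI nz12); rewrite mulfV //.
  by have := congr1 val iK; rewrite rmorphM rmorph1 rmorph_nat.
move=> u; have uE : u = loc_val U.
  rewrite -[RHS]/(val _) !(rmorphM, rmorphD, rmorphXn, rmorph_nat) /= valMi vali.
  by rewrite /u; field.
have [congH congH2] := hasse_clausen p_pr p_gt3 pE N MK iK.
have congS := cubic_char_sum_eqm p_pr p_gt3 pE M N.
have congL := legendre_eqm p_pr p_gt3 pE (- 3 * M).
set S := cubic_char_sum p m n; set L := legendre p _.
have {}congS : eqm p (S%:~R : localized p) (- (cubic M N ^+ h)`_h.*2) := congS.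
have {}congL : eqm p (L%:~R : localized p) ((- 3 * M) ^+ h) := congL.
have val_LB K : L%:~R * binom_sum K u = loc_val (L%:~R * sextic_cube_sum K U).
  by rewrite -[RHS]/(val _) rmorphM rmorph_int /= uE loc_val_binom_sum.
split.
- by rewrite uE; apply: (valP U).
- have -> : S%:~R ^+ 2 = loc_val (S%:~R ^+ 2 : localized p).
    by rewrite -[RHS]/(val _) rmorphXn rmorph_int.
  rewrite val_LB; apply: eqm_Rp_congr.
  apply: (eqm_trans (eqmM congS congS)); rewrite mulrNN -expr2.
  by apply: (eqm_trans congH); apply/eqmMr/eqm_sym.
- by rewrite !val_LB; apply/eqm_Rp_congr/eqmMl/(sextic_cube_sum_trunc _ p_pr p_gt3).
move=> S0; rewrite uE loc_val_binom_sum -[0]/(loc_val (0 : localized p)).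
apply/eqm_Rp_congr/congH2; case: congS => z; rewrite S0 => E.
exists z; rewrite add0r; apply: (addrI (- (cubic M N ^+ h)`_h.*2)).
by rewrite addNr -E.
Qed.
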